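(* Let $k\ge 0$ be an integer and let $S$ be a set of vertices in a graph $G\in\widehat{\mathcal{D}}_k$. Let $G'$ be the graph obtained from $G$ by adding one new vertex adjacent to every vertex in $S$ (and to no other vertex). Then $G'\in\widehat{\mathcal{D}}_{k+1}$ if and only if $S$ is the set of vertices of degree $k+1$ in $G$.
   Context: All graphs are undirected, simple, finite and non-empty. A graph $H$ is a minor of $G$ if a graph isomorphic to $H$ can be obtained from $G$ by a sequence of edge contractions, edge deletions and vertex deletions (after a contraction, parallel edges are replaced by a single edge). $\mathcal{D}_k$ is the class of graphs $G$ such that every minor of $G$ has minimum degree at most $k$. $\widehat{\mathcal{D}}_k$ is the set of minimal forbidden minors of $\mathcal{D}_k$: the graphs $G\notin\mathcal{D}_k$ such that every proper minor of $G$ is in $\mathcal{D}_k$. *)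

(* Defs.v *)
From mathcomp Require Import all_boot.

Set Implicit Arguments.
Unset Strict Implicit.
Unset Printing Implicit Defensive.

(* Finite, simple, undirected, non-empty graphs. *)
Record graph := Graph {
  vertex :> finType;
  adj : rel vertex;
  adj_sym : symmetric adj;
  adj_irrefl : irreflexive adj;
  graph_nonempty : 0 < #|vertex|
}.

Definition iso (G H : graph) : Prop :=
  exists2 f : G -> H, bijective f & forall x y, adj (f x) (f y) = adj x y.

Definition deg (G : graph) (v : G) : nat := #|[set u | adj v u]|.

(* Every degree is < #|G| and G is non-empty, so the neutral value #|G| never
   contributes: this is the true minimum of the degrees. *)
Definition min_deg (G : graph) : nat := \big[minn/#|G|]_(v : G) deg v.

Section Operations.
Variable G : graph.

Section DeleteEdge.
Variables x y : G.

Definition del_edge_rel : rel G :=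
  [rel a b | adj a b && ([set a; b] != [set x; y])].

Lemma del_edge_sym : symmetric del_edge_rel.
Proof. by move=> a b; rewrite /del_edge_rel /= adj_sym setUC. Qed.

Lemma del_edge_irrefl : irreflexive del_edge_rel.
Proof. by move=> a; rewrite /del_edge_rel /= adj_irrefl. Qed.

Definition del_edge : graph :=
  Graph del_edge_sym del_edge_irrefl (graph_nonempty G).
End DeleteEdge.

Section DeleteVertex.
Variables (v : G) (G_gt1 : 1 < #|G|).

Definition del_vertex_rel : rel {u : G | u != v} :=
  [rel a b | adj (val a) (val b)].

Lemma del_vertex_sym : symmetric del_vertex_rel.
Proof. by move=> a b; rewrite /del_vertex_rel /= adj_sym. Qed.

Lemma del_vertex_irrefl : irreflexive del_vertex_rel.
Proof. by move=> a; rewrite /del_vertex_rel /= adj_irrefl. Qed.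

Lemma del_vertex_nonempty : 0 < #|{: {u : G | u != v}}|.
Proof. by rewrite card_sig (cardC1 v) -ltnS prednK // ltnW. Qed.

Definition del_vertex : graph :=
  Graph del_vertex_sym del_vertex_irrefl del_vertex_nonempty.
End DeleteVertex.

(* Contraction of the edge xy: y is removed, and x, which now stands for the
   merged vertex, inherits the neighbours of y. *)
Section Contract.
Variables (x y : G) (xy : adj x y).

Definition contract_rel : rel {u : G | u != y} :=
  [rel a b | (val a != val b) &&
    [|| adj (val a) (val b),
        (val a == x) && adj y (val b) |
        (val b == x) && adj y (val a)]].

Lemma contract_sym : symmetric contract_rel.
Proof. by move=> a b; rewrite /contract_rel /= eq_sym adj_sym [in X in _ || X]orbC. Qed.

Lemma contract_irrefl : irreflexive contract_rel.
Proof. by move=> a; rewrite /contract_rel /= eqxx. Qed.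

Lemma contract_nonempty : 0 < #|{: {u : G | u != y}}|.
Proof.
have xNy : x != y by apply: contraTneq xy => ->; rewrite adj_irrefl.
by apply/card_gt0P; exists (exist _ x xNy).
Qed.

Definition contract : graph :=
  Graph contract_sym contract_irrefl contract_nonempty.
End Contract.

Section AddVertex.
Variable S : {set G}.

Definition add_vertex_rel : rel (option G) := fun a b =>
  match a, b with
  | Some u, Some v => adj u v
  | Some u, None | None, Some u => u \in S
  | None, None => false
  end.

Lemma add_vertex_sym : symmetric add_vertex_rel.
Proof. by move=> [a|] [b|] //=; rewrite adj_sym. Qed.

Lemma add_vertex_irrefl : irreflexive add_vertex_rel.
Proof. by move=> [a|] //=; rewrite adj_irrefl. Qed.

Lemma add_vertex_nonempty : 0 < #|{: option G}|.
Proof. by rewrite card_option. Qed.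

Definition add_vertex : graph :=
  Graph add_vertex_sym add_vertex_irrefl add_vertex_nonempty.
End AddVertex.

End Operations.

Inductive reduces_to (G : graph) : graph -> Prop :=
| reduces_refl : reduces_to G G
| reduces_contract (K : graph) (x y : K) (xy : adj x y) :
    reduces_to G K -> reduces_to G (contract xy)
| reduces_del_edge (K : graph) (x y : K) (xy : adj x y) :
    reduces_to G K -> reduces_to G (del_edge x y)
| reduces_del_vertex (K : graph) (v : K) (K_gt1 : 1 < #|K|) :
    reduces_to G K -> reduces_to G (del_vertex v K_gt1).

Definition minor (H G : graph) : Prop :=
  exists2 K : graph, reduces_to G K & iso K H.

Definition proper_minor (H G : graph) : Prop := minor H G /\ ~ iso H G.

(* The class D_k. *)
Definition Dclass (k : nat) (G : graph) : Prop :=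
  forall H : graph, minor H G -> min_deg H <= k.

(* The set of minimal forbidden minors of D_k. *)
Definition Dhat (k : nat) (G : graph) : Prop :=
  ~ Dclass k G /\ forall H : graph, proper_minor H G -> Dclass k H.

(* Main.v *)
(* Minors are handled through branch-set models.  Write [T] for the set of
   vertices of degree k+1.  Every edge of a graph in Dhat_k meets [T], whence
   |T| >= k+2, so G' has minimum degree at least k+2 when S = T.  If a minor N
   of a proper minor of G' had minimum degree at least k+2, removing from N the
   vertex whose branch set holds the new vertex would leave a minor of G with
   minimum degree at least k+1, hence a copy of G; the removed vertex must be
   adjacent to all copies of vertices of T, so G' embeds in the smaller graph N.
   Conversely, if G' is in Dhat_{k+1} then T is contained in S, and an edge from
   the new vertex to S \ T would have two ends of degree greater than k+2. *)
Require Import Defs.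
From mathcomp Require Import all_boot.

Set Implicit Arguments.
Unset Strict Implicit.
Unset Printing Implicit Defensive.

(** * Minimum degree and its invariance under isomorphism *)

Lemma deg_lt_card (G : graph) (v : G) : deg v < #|G|.
Proof.
rewrite -cardsT; apply: proper_card; rewrite properE subsetT /=.
by apply/subsetPn; exists v; rewrite !inE ?adj_irrefl.
Qed.

Lemma min_degP (G : graph) (m : nat) :
  reflect (forall v : G, m <= deg v) (m <= min_deg G).
Proof.
apply: (iffP idP) => [le_m v | le_m].
  apply: leq_trans le_m _; rewrite /min_deg; elim: index_enum (mem_index_enum v) => // w r IHr.
  by rewrite inE big_cons geq_min => /predU1P[-> | /IHr ->]; rewrite ?leqnn ?orbT.
rewrite /min_deg; elim/big_ind: _ => [|a b ma mb|v _]; last exact: le_m.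
(* The neutral value [#|G|] is also at least [m], since it exceeds the degree of any vertex. *)
- by case/card_gt0P: (graph_nonempty G) => v _; apply: leq_trans (le_m v) (ltnW (deg_lt_card v)).
- by rewrite leq_min ma mb.
Qed.

Lemma iso_refl (G : graph) : iso G G.
Proof. by exists id => //; exists id. Qed.

Lemma iso_sym (G H : graph) : iso G H -> iso H G.
Proof.
case=> f [g fK gK] f_adj; exists g; first by exists f.
by move=> x y; rewrite -f_adj !gK.
Qed.

Lemma iso_deg (G H : graph) (f : G -> H) (v : G) :
  bijective f -> (forall x y, adj (f x) (f y) = adj x y) -> deg (f v) = deg v.
Proof.
move=> f_bij f_adj; rewrite /deg -(card_imset [set u | adj v u] (bij_inj f_bij)).
case: f_bij => g fK gK; apply: eq_card => w; rewrite inE -{1}(gK w) f_adj.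
by apply/idP/imsetP => [vw | [u]]; [exists (g w); rewrite ?inE ?gK | rewrite inE => ? ->; rewrite fK].
Qed.

Lemma iso_min_deg (G H : graph) : iso G H -> min_deg G <= min_deg H.
Proof.
move/iso_sym=> [f f_bij f_adj]; apply/min_degP => v.
by rewrite -(iso_deg v f_bij f_adj); apply/min_degP.
Qed.

(** * Minor models *)

(* [phi a] is the vertex of [H] whose branch set contains [a], or [None] when
   [a] is unused.  Connectedness of branch sets is phrased as an induction
   principle along the edges inside a branch set. *)
Definition is_model (G H : graph) (phi : G -> option H) : Prop :=
  [/\ forall h, exists a, phi a = Some h,
      forall h (P : G -> Prop),
        (forall a b, adj a b -> phi a = Some h -> phi b = Some h -> P a -> P b) ->
        forall a b, phi a = Some h -> phi b = Some h -> P a -> P b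
    & forall h h', adj h h' ->
        exists a b, [/\ phi a = Some h, phi b = Some h' & adj a b]].

Definition has_model (H G : graph) : Prop := exists phi : G -> option H, is_model phi.

(** Branch sets are the singletons [f h]. Edges need only be preserved, not reflected, so any
    subgraph qualifies. *)
Lemma embedding_model (G H : graph) (f : H -> G) :
  injective f -> (forall a b, adj a b -> adj (f a) (f b)) -> has_model H G.
Proof.
move=> f_inj f_adj; pose phi a := [pick h | f h == a].
have phi_f h : phi (f h) = Some h.
  by rewrite /phi; case: pickP => [h' /eqP/f_inj -> // | /(_ h)]; rewrite eqxx.
have phiE a h : phi a = Some h -> a = f h.
  by rewrite /phi; case: pickP => // h' /eqP <- [->].
exists phi; split=> [h | h P _ a b | h h' hh'].
- by exists (f h).
- by move=> /phiE -> /phiE ->.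
- by exists (f h), (f h'); split=> //; apply: f_adj.
Qed.

Lemma iso_model (G H : graph) : iso G H -> has_model G H.
Proof.
by case=> f /bij_inj f_inj f_adj; apply: (embedding_model f_inj) => a b; rewrite f_adj.
Qed.

Lemma model_trans (G H K : graph) : has_model H G -> has_model K H -> has_model K G.
Proof.
move=> [phi [phi_surj phi_conn phi_adj]] [psi [psi_surj psi_conn psi_adj]].
exists (fun a => obind psi (phi a)); split=> [k | k P Pclosed a b | k k' kk'].
- have [h hk] := psi_surj k; have [a ah] := phi_surj h.
  by exists a; rewrite ah.
- case a_h: (phi a) => [h|] //= h_k; case b_h: (phi b) => [h'|] //= h'_k Pa.
  (* The branch set of [k] is a union of branch sets of [phi]. [P] fills each of these by
     [phi_conn], and [Q], saying that one is filled, passes between them by [psi_conn]. *)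
  pose Q h := forall c, phi c = Some h -> P c.
  have spread h1 c : psi h1 = Some k -> phi c = Some h1 -> P c -> Q h1.
    move=> h1_k c_h1 Pc d d_h1; apply: (phi_conn h1 P _ c d) => // e e' ee' eh e'h.
    by apply: Pclosed; rewrite ?eh ?e'h.
  suff: Q h' by apply.
  apply: (psi_conn k Q _ h) => //; last exact: spread Pa.
  move=> h1 h2 /phi_adj [c [d [c_h1 d_h2 cd]]] h1_k h2_k Qh1.
  apply: (spread _ d) => //; apply: Pclosed (Qh1 _ c_h1) => //.
  + by rewrite c_h1.
  + by rewrite d_h2.
- have [h [h' [h_k h'_k /phi_adj [a [b [a_h b_h ab]]]]]] := psi_adj _ _ kk'.
  by exists a, b; rewrite a_h b_h.
Qed.

Lemma del_edge_model (G : graph) (x y : G) : has_model (del_edge x y) G.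
Proof. by apply: (@embedding_model G (del_edge x y) id) => // a b /andP[]. Qed.

Lemma del_vertex_model (G : graph) (v : G) (G_gt1 : 1 < #|G|) :
  has_model (del_vertex v G_gt1) G.
Proof. by apply: (@embedding_model G (del_vertex v G_gt1) val) => //; apply: val_inj. Qed.

Section ContractMap.
Variables (G : graph) (x y : G) (xy : adj x y).

Definition merge (u : G) : G := if u == y then x else u.

Lemma merge_neq (u : G) : merge u != y.
Proof.
rewrite /merge; case: (eqVneq u y) => // _.
by apply: contraTneq xy => ->; rewrite adj_irrefl.
Qed.

Definition contract_map (u : G) : contract xy := exist _ (merge u) (merge_neq u).

Lemma contract_mapK (s : contract xy) : contract_map (val s) = s.
Proof. by apply: val_inj; rewrite /= /merge (negPf (valP s)). Qed.

Lemma contract_map_adj (u w : G) :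
  adj u w -> contract_map u != contract_map w -> adj (contract_map u) (contract_map w).
Proof.
move=> uw; rewrite -val_eqE /= /contract_rel /= => neq; rewrite neq /=.
move: neq uw; rewrite /merge.
case: (eqVneq u y) => [->|uy]; case: (eqVneq w y) => [->|wy]; rewrite ?eqxx //.
- by move=> _ ->; rewrite !orbT.
- by move=> _; rewrite [adj u y]adj_sym => ->; rewrite !orbT.
- by move=> _ ->.
Qed.

(** The branch sets are the fibres of [contract_map]: singletons, except for the pair of [x] and
    [y], joined by the edge [xy]. *)
Lemma contract_model : has_model (contract xy) G.
Proof.
exists (fun u => Some (contract_map u)); split=> [h | h P Pclosed a b [ah] [bh] | h h'].
- by exists (val h); rewrite contract_mapK.
- have [-> // | neq] := eqVneq a b; apply: Pclosed; rewrite ?ah ?bh //.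
  have /= := congr1 val (etrans ah (esym bh)); rewrite /merge.
  case: (eqVneq a y) neq => [->|ay]; case: (eqVneq b y) => [->|b_y]; rewrite ?eqxx //.
  + by move=> _ <-; rewrite adj_sym.
  + by move=> _ ->.
  + by move=> /eqP.
- have x_h (s : contract xy) : val s == x -> contract_map y = s.
    by move/eqP=> sx; apply: val_inj; rewrite /= /merge eqxx sx.
  case/andP=> _ /or3P[hh' | /andP[hx yh'] | /andP[h'x yh]].
  + by exists (val h), (val h'); rewrite !contract_mapK.
  + by exists y, (val h'); rewrite !contract_mapK (x_h _ hx).
  + by exists (val h), y; rewrite !contract_mapK (x_h _ h'x) adj_sym.
Qed.

End ContractMap.

Lemma reduces_to_model (G K : graph) : reduces_to G K -> has_model K G.
Proof.
elim=> [|L x y xy _ GL|L x y xy _ GL|L v L_gt1 _ GL].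
- exact: (@embedding_model G G id).
- exact: model_trans GL (contract_model xy).
- exact: model_trans GL (del_edge_model x y).
- exact: model_trans GL (del_vertex_model v L_gt1).
Qed.

Lemma minor_model (H G : graph) : minor H G -> has_model H G.
Proof.
by case=> K /reduces_to_model GK /iso_sym /iso_model; apply: model_trans.
Qed.

(** * Size *)

Definition arcs (G : graph) : {set G * G} := [set p | adj p.1 p.2].

(** Every reduction operation strictly decreases this measure, and models never increase it. It thus
    separates a graph from its proper minors and drives the induction that turns models into
    minors. *)
Definition gsize (G : graph) : nat := #|G| + #|arcs G|.

Lemma leq_card_surj (T U : finType) (A : {set T}) (B : {set U}) (f : T -> option U) :
  (forall b, b \in B -> exists2 a, a \in A & f a = Some b) -> #|B| <= #|A|.
Proof.
move=> surj; have Some_inj : injective (@Some U) by move=> ? ? [].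
rewrite -(card_imset B Some_inj); apply: leq_trans (leq_imset_card f A).
apply: subset_leq_card; apply/subsetP=> _ /imsetP[b /surj[a aA <-] ->].
exact: imset_f.
Qed.

Lemma model_arcs (H G : graph) : has_model H G -> #|arcs H| <= #|arcs G|.
Proof.
move=> [phi [_ _ phi_adj]].
pose f (p : G * G) := obind (fun h => omap (pair h) (phi p.2)) (phi p.1).
apply: (@leq_card_surj _ _ _ _ f) => -[h h']; rewrite inE /=.
by case/phi_adj=> a [b [ah bh' ab]]; exists (a, b); rewrite ?inE // /f /= ah bh'.
Qed.

Lemma model_size (H G : graph) : has_model H G -> gsize H <= gsize G.
Proof.
move=> HG; rewrite leq_add ?model_arcs //; have [phi [phi_surj _ _]] := HG.
rewrite -!cardsT; apply: (@leq_card_surj _ _ _ _ phi) => h _.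
by have [a] := phi_surj h; exists a.
Qed.

Lemma contract_size (G : graph) (x y : G) (xy : adj x y) : gsize (contract xy) < gsize G.
Proof.
rewrite -addSn leq_add ?(model_arcs (contract_model xy)) //.
by rewrite card_sig (cardC1 y) prednK // graph_nonempty.
Qed.

Lemma del_vertex_size (G : graph) (v : G) (G_gt1 : 1 < #|G|) :
  gsize (del_vertex v G_gt1) < gsize G.
Proof.
rewrite -addSn leq_add ?(model_arcs (del_vertex_model v G_gt1)) //.
by rewrite card_sig (cardC1 v) prednK // graph_nonempty.
Qed.

Lemma del_edge_size (G : graph) (x y : G) : adj x y -> gsize (del_edge x y) < gsize G.
Proof.
move=> xy; rewrite -addnS leq_add //; apply: proper_card; apply/properP; split.
  by apply/subsetP=> p; rewrite !inE => /andP[].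
by exists (x, y); rewrite !inE //= /del_edge_rel /= eqxx andbF.
Qed.

Lemma reduces_to_size (G K : graph) : reduces_to G K -> G = K \/ gsize K < gsize G.
Proof.
have step (L M : graph) : G = L \/ gsize L < gsize G -> gsize M < gsize L -> gsize M < gsize G.
  by move=> [->|LG] // ML; apply: ltn_trans LG.
elim=> [|L x y xy _ GL|L x y xy _ GL|L v L_gt1 _ GL]; [by left | right..].
- exact: step GL (contract_size xy).
- exact: step GL (del_edge_size xy).
- exact: step GL (del_vertex_size v L_gt1).
Qed.

Lemma proper_minor_size (H G : graph) : proper_minor H G -> gsize H < gsize G.
Proof.
move=> [[K GK KH] nHG].
case: (reduces_to_size GK) => [eqGK | KG].
  by case: nHG; rewrite eqGK; apply: iso_sym.
exact: leq_ltn_trans (model_size (iso_model (iso_sym KH))) KG.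
Qed.

(** * From models to minors *)

Lemma contract_is_model (G H : graph) (phi : G -> option H) (x y : G) (xy : adj x y) :
  is_model phi -> phi x = phi y ->
  is_model (fun s : contract xy => phi (val s)).
Proof.
move=> [phi_surj phi_conn phi_adj] phi_xy.
have phi_map u : phi (val (contract_map xy u)) = phi u.
  by rewrite /= /merge; case: eqP => // ->.
split=> [h | h P Pclosed s t s_h t_h Ps | h h' hh'].
- by have [a <-] := phi_surj h; exists (contract_map xy a).
- rewrite -(contract_mapK t).
  apply: (phi_conn h (fun u => P (contract_map xy u)) _ (val s)) => //; last first.
    by rewrite contract_mapK.
  move=> a b ab ah bh Pa.
  have [<- //| neq] := eqVneq (contract_map xy a) (contract_map xy b).
  by apply: Pclosed Pa; rewrite ?phi_map //; apply: contract_map_adj.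
- have [a [b [ah bh' ab]]] := phi_adj _ _ hh'.
  exists (contract_map xy a), (contract_map xy b); rewrite !phi_map; split=> //.
  apply: contract_map_adj => //; apply: contraTneq hh' => eq_ab.
  have : Some h = Some h' by rewrite -ah -bh' -(phi_map a) -(phi_map b) eq_ab.
  by case=> ->; rewrite adj_irrefl.
Qed.

Lemma del_vertex_is_model (G H : graph) (phi : G -> option H) (v : G) (G_gt1 : 1 < #|G|) :
  is_model phi -> phi v = None ->
  is_model (fun s : del_vertex v G_gt1 => phi (val s)).
Proof.
move=> [phi_surj phi_conn phi_adj] phi_v.
have used a h : phi a = Some h -> a != v.
  by apply: contra_eqN => /eqP ->; rewrite phi_v.
split=> [h | h P Pclosed s t s_h t_h Ps | h h' hh'].
- by have [a ah] := phi_surj h; exists (exist _ a (used _ _ ah)).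
- pose Q u := forall s : del_vertex v G_gt1, val s = u -> P s.
  apply: (phi_conn h Q _ (val s) (val t)) => //; last by move=> ? /val_inj ->.
  move=> a b ab ah bh Qa r rb.
  apply: (Pclosed (exist _ a (used _ _ ah)) r) => //; last exact: Qa.
  + by rewrite /= /del_vertex_rel /= rb.
  + by rewrite rb.
- have [a [b [ah bh' ab]]] := phi_adj _ _ hh'.
  by exists (exist _ a (used _ _ ah)), (exist _ b (used _ _ bh')).
Qed.

Lemma inj_surj_bij (T U : choiceType) (f : T -> U) :
  injective f -> (forall b, exists a, f a = b) -> bijective f.
Proof.
move=> f_inj f_surj.
have f_surjb b : exists a, f a == b by have [a <-] := f_surj b; exists a.
have gK : cancel (fun b => xchoose (f_surjb b)) f.
  by move=> b; apply/eqP; apply: (xchooseP (f_surjb b)).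
by exists (fun b => xchoose (f_surjb b)) => // a; apply: f_inj; rewrite gK.
Qed.

Lemma model_reduces (G K H : graph) :
  reduces_to G K -> has_model H K -> minor H G.
Proof.
have [n] := ubnP (gsize K); elim: n K => // n IHn K /ltnSE le_n GK [phi phi_model].
have [phi_surj phi_conn phi_adj] := phi_model.
case: (pickP (fun v => phi v == None)) => [v /eqP phi_v | all_used].
  have K_gt1 : 1 < #|K|.
    have /card_gt0P[h _] := graph_nonempty H; have [a ah] := phi_surj h.
    have av : a != v by apply: contra_eq_neq ah => ->; rewrite phi_v.
    by rewrite -cardsT (cardsD1 v) inE ltnS; apply/card_gt0P; exists a; rewrite !inE av.
  apply: (IHn (del_vertex v K_gt1)).
  - exact: leq_trans (del_vertex_size v K_gt1) le_n.
  - exact: reduces_del_vertex.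
  - by exists (fun s => phi (val s)); apply: del_vertex_is_model.
case: (pickP (fun p : K * K => adj p.1 p.2 && (phi p.1 == phi p.2))).
  move=> [x y] /= /andP[xy /eqP phi_xy]; apply: (IHn (contract xy)).
  - exact: leq_trans (contract_size xy) le_n.
  - exact: reduces_contract.
  - by exists (fun s => phi (val s)); apply: contract_is_model.
move=> no_inner; have [f phiE] : exists f : K -> H, forall a, phi a = Some (f a).
  have /card_gt0P[h _] := graph_nonempty H.
  by exists (fun a => odflt h (phi a)) => a; case: (phi a) (all_used a).
have f_inj : injective f.
  (* No edge lies inside a branch set, so [eq a] is vacuously closed and connectedness makes the
     branch set a singleton. *)
  move=> a b fab; apply: (phi_conn (f b) (eq a) _ a b) => //; rewrite ?phiE ?fab //.
  move=> c d cd ch dh; have := no_inner (c, d).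
  by rewrite /= cd ch dh eqxx.
have f_bij : bijective f.
  apply: (inj_surj_bij f_inj) => h.
  by have [a] := phi_surj h; rewrite phiE => -[]; exists a.
case: (pickP (fun p : K * K => adj p.1 p.2 && ~~ adj (f p.1) (f p.2))).
  move=> [x y] /= /andP[xy nfxy]; apply: (IHn (del_edge x y)).
  - exact: leq_trans (del_edge_size xy) le_n.
  - exact: reduces_del_edge.
  - have [g fK gK] := f_bij.
    apply: (@embedding_model (del_edge x y) H g) => [|h h' hh']; first exact: can_inj gK.
    have [a [b]] := phi_adj _ _ hh'; rewrite !phiE => -[[fa] [fb] ab].
    rewrite -fa -fb /= /del_edge_rel /= !fK ab /=.
    (* The edge realizing [hh'] is not the deleted one, whose ends have non-adjacent images in
       [H]. *)
    apply: contra nfxy => /eqP eq_ab; rewrite -fa -fb in hh'.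
    have: x \in [set a; b] by rewrite eq_ab !inE eqxx.
    have: y \in [set a; b] by rewrite eq_ab !inE eqxx orbT.
    move: xy; rewrite !inE => xy /orP[] /eqP ey /orP[] /eqP ex; subst x y => //.
    + by rewrite adj_irrefl in xy.
    + by rewrite adj_sym.
    + by rewrite adj_irrefl in xy.
move=> no_extra; exists K => //; exists f => //.
move=> a b; apply/idP/idP => [/phi_adj [c [d]] | ab].
  by rewrite !phiE => -[[/f_inj <-] [/f_inj <-]].
by have := no_extra (a, b); rewrite /= ab => /negbFE.
Qed.

Lemma model_minor (H G : graph) : has_model H G -> minor H G.
Proof. exact: model_reduces (reduces_refl G). Qed.

Lemma minor_refl (G : graph) : minor G G.
Proof. by exists G; [apply: reduces_refl | apply: iso_refl]. Qed.

(** * Degrees *)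

Lemma deg_del_edge (G : graph) (x y v : G) : adj x y ->
  deg v <= (v \in [set x; y]) + @deg (del_edge x y) v.
Proof.
move=> xy; have xNy : x == y = false.
  by apply: contraTF xy => /eqP ->; rewrite adj_irrefl.
have [vxy | v_xy] := boolP (v \in [set x; y]); last first.
  apply/subset_leq_card/subsetP=> u; rewrite !inE /= /del_edge_rel /= => -> /=.
  by apply: contraNneq v_xy => <-; rewrite !inE eqxx.
(* [w] is the other end of the deleted edge, the only neighbour that [v] loses. *)
have [w wE] : exists w, [set x; y] = [set v; w] /\ v != w.
  move: vxy; rewrite !inE => /orP[] /eqP ->; first by exists y; rewrite xNy.
  by exists x; rewrite eq_sym xNy setUC.
rewrite {1}/deg (cardsD1 w) leq_add ?leq_b1 //.
apply/subset_leq_card/subsetP=> u; rewrite !inE /= /del_edge_rel /= => /andP[uw ->] /=.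
case: wE => -> vw; apply: contra uw => /eqP vuE.
have: w \in [set v; u] by rewrite vuE !inE eqxx orbT.
by rewrite !inE [w == v]eq_sym (negPf vw) eq_sym.
Qed.

Lemma deg_del_vertex (G : graph) (x : G) (G_gt1 : 1 < #|G|) (h : del_vertex x G_gt1) :
  deg (val h) = adj (val h) x + deg h.
Proof.
rewrite {1}/deg (cardsD1 x) inE; congr (_ + _); rewrite /deg -(card_imset _ val_inj).
apply: eq_card => u; rewrite !inE; apply/andP/imsetP => [[ux hu] | [s + ->]].
  by exists (exist _ u ux); rewrite ?inE.
by rewrite inE => hs; split=> //; apply: (valP s).
Qed.

Lemma deg_add_vertex_None (G : graph) (S : {set G}) : @deg (add_vertex S) None = #|S|.
Proof.
have Some_inj : injective (@Some G) by move=> ? ? [].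
rewrite -(card_imset S Some_inj); apply: eq_card => -[u|]; rewrite inE /=.
  by rewrite mem_imset.
by apply/esym/imsetP => -[].
Qed.

Lemma deg_add_vertex_Some (G : graph) (S : {set G}) (u : G) :
  @deg (add_vertex S) (Some u) = (u \in S) + deg u.
Proof.
have Some_inj : injective (@Some G) by move=> ? ? [].
rewrite /deg (cardsD1 None) inE /=; congr (_ + _).
rewrite -(card_imset _ Some_inj); apply: eq_card => -[w|]; rewrite !inE /=.
  by rewrite mem_imset // inE.
by apply/esym/imsetP => -[].
Qed.

(** * Minimal forbidden minors *)

Section MinimalForbiddenMinor.
Variables (k : nat) (G : graph).
Hypothesis hG : Dhat k G.

(* [iso] is not known to be decidable, whence the double negation. *)
Lemma Dhat_minor_iso (M : graph) : minor M G -> k < min_deg M -> ~ ~ iso M G.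
Proof.
move=> MG; rewrite ltnNge => /negP M_deg nMG; apply: M_deg.
by case: hG => _ crit; apply: (crit M) => //; apply: minor_refl.
Qed.

Lemma Dhat_min_deg : k < min_deg G.
Proof.
rewrite ltnNge; apply/negP=> G_deg; case: hG => notD _; apply: notD => M MG.
rewrite leqNgt; apply/negP=> M_deg; apply: (Dhat_minor_iso MG M_deg) => /iso_min_deg.
by move=> /leq_trans/(_ G_deg); rewrite leqNgt M_deg.
Qed.

Lemma Dhat_deg (v : G) : k < deg v.
Proof. exact: (min_degP _ _ Dhat_min_deg). Qed.

(** If both ends had larger degree, deleting the edge would keep all degrees above [k]. The result
    would be a copy of [G] of smaller size. *)
Lemma Dhat_edge (x y : G) : adj x y -> (deg x == k.+1) || (deg y == k.+1).
Proof.
move=> xy; apply: contraT; rewrite negb_or => /andP[dx dy].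
have E_deg : k < min_deg (del_edge x y).
  apply/min_degP => v; have := @deg_del_edge G x y v xy; have := Dhat_deg v.
  case: (boolP (v \in [set x; y])) => [vxy dv | _]; last exact: leq_trans.
  rewrite add1n => le_v; rewrite -ltnS (leq_trans _ le_v) //.
  by rewrite ltn_neqAle dv andbT eq_sym; case/set2P: vxy => ->.
case: (Dhat_minor_iso (model_minor (del_edge_model x y)) E_deg).
by move=> /iso_sym/iso_model/model_size; rewrite leqNgt del_edge_size.
Qed.

(** A vertex of degree at least k+2 has all its neighbours in the set, by [Dhat_edge]. Without such
    a vertex the set is all of [G], which has more vertices than any degree. *)
Lemma Dhat_card_min : k.+1 < #|[set v : G | deg v == k.+1]|.
Proof.
have [v dv | all_min] := pickP (fun v : G => deg v != k.+1).
  apply: (@leq_trans (deg v)); first by rewrite ltn_neqAle eq_sym dv Dhat_deg.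
  apply/subset_leq_card/subsetP=> u; rewrite !inE => /Dhat_edge.
  by rewrite (negPf dv).
have /card_gt0P[v _] := graph_nonempty G.
have /negbFE/eqP <- := all_min v; rewrite (leq_trans (deg_lt_card v)) // -cardsT.
by apply/subset_leq_card/subsetP=> u _; rewrite inE (eqP (negbFE (all_min v))) (negbFE (all_min u)).
Qed.

End MinimalForbiddenMinor.

(** * The graph with the new vertex *)

Lemma min_deg_add_vertex (k : nat) (G : graph) : Dhat k G ->
  k.+1 < min_deg (add_vertex [set v : G | deg v == k.+1]).
Proof.
move=> hG; apply/min_degP => -[u|].
  rewrite deg_add_vertex_Some inE; have := Dhat_deg hG u.
  by case: eqVneq => [-> | du dk]; rewrite // add0n ltn_neqAle eq_sym du.
by rewrite deg_add_vertex_None Dhat_card_min.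
Qed.

(* [x] is the vertex of [H] whose branch set contains the new vertex, or any
   vertex if the new vertex is unused. *)
Lemma add_vertex_model_del (G H : graph) (S : {set G}) (H_gt1 : 1 < #|H|) :
  has_model H (add_vertex S) -> exists x : H, has_model (del_vertex x H_gt1) G.
Proof.
move=> [phi [phi_surj phi_conn phi_adj]].
have [x phi_None] : exists x, forall h, phi None = Some h -> h = x.
  case phi_N: (phi None) => [x|]; first by exists x => h [].
  by have /card_gt0P[x _] := graph_nonempty H; exists x.
pose psi (a : G) : option (del_vertex x H_gt1) := obind insub (phi (Some a)).
have psiE a h : psi a = Some h <-> phi (Some a) = Some (val h).
  rewrite /psi; case: (phi _) => [h'|] //=; split=> [|[->]]; last by rewrite valK.
  by case: insubP => // s _ <- [->].
have used (a : add_vertex S) (h : del_vertex x H_gt1) :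
    phi a = Some (val h) -> exists2 b, a = Some b & psi b = Some h.
  case: a => [b /psiE|/phi_None hx]; first by exists b.
  by have := valP h; rewrite hx eqxx.
exists x, psi; split=> [h | h P Pclosed a b /psiE ah /psiE bh Pa | h h' /phi_adj].
- by have [a /used[b _]] := phi_surj (val h); exists b.
(* The value [False] at the new vertex is harmless: only the branch set of [x] can contain that
   vertex, and [h] differs from [x]. *)
- apply: (phi_conn (val h) (oapp P False) _ (Some a) (Some b)) => //.
  move=> c d cd /used[c' ec ch] /used[d' ed dh]; subst c d.
  exact: Pclosed.
- move=> [a [b [/used[a' -> ah] /used[b' -> bh'] ab]]].
  by exists a', b'.
Qed.

Theorem theorem1p2 (k : nat) (G : graph) (S : {set G}) (hG : Dhat k G) :
  Dhat k.+1 (add_vertex S) <-> S = [set v : G | deg v == k.+1].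
Proof.
set T := [set v : G | _]; split=> [hG' | ->].
  (* A vertex of [T] outside [S] would keep degree k+1 in G', below the required k+2. *)
  have subTS : T \subset S.
    apply/subsetP=> v; rewrite inE => /eqP dv; have := Dhat_deg hG' (Some v).
    by rewrite deg_add_vertex_Some dv; case: (v \in S); rewrite // ltnn.
  apply/eqP; rewrite eqEsubset subTS andbT; apply/subsetP=> s sS.
  (* One end of the edge from the new vertex to [s] has degree k+2. For the new vertex this
     contradicts |S| > |T| >= k+2; for [s] it puts [s] in [T]. *)
  apply: contraT => sNT; have := @Dhat_edge _ _ hG' None (Some s) sS.
  rewrite deg_add_vertex_None deg_add_vertex_Some sS add1n eqSS => /orP[/eqP card_S | ds].
    have : #|T| < #|S| by apply: proper_card; apply/properP; split=> //; exists s.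
    by rewrite card_S ltnNge (Dhat_card_min hG).
  by rewrite inE ds in sNT.
have G'_deg := min_deg_add_vertex hG; split.
  by move=> /(_ _ (minor_refl _)); rewrite leqNgt G'_deg.
move=> H HG' N NH; rewrite leqNgt; apply/negP=> N_deg.
have N_gt1 : 1 < #|N|.
  have /card_gt0P[x _] := graph_nonempty N.
  apply: leq_ltn_trans (deg_lt_card x).
  exact: leq_trans (ltn0Sn _) (ltnW (min_degP _ _ N_deg x)).
have NG' : has_model N (add_vertex T).
  by apply: model_trans (minor_model NH); case: HG' => /minor_model.
have [x MG] := add_vertex_model_del N_gt1 NG'; set M := del_vertex x N_gt1 in MG.
have N_degM (h : M) : k.+1 < adj (val h) x + deg h.
  by rewrite -deg_del_vertex; apply: (min_degP _ _ N_deg).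
have M_deg : k < min_deg M.
  apply/min_degP => h; rewrite -ltnS (leq_trans (N_degM h)) // -add1n.
  by rewrite leq_add2r leq_b1.
(* The goal is [False], so the double negation yields an actual isomorphism. *)
apply: (Dhat_minor_iso hG (model_minor MG) M_deg) => /iso_sym [f f_bij f_adj].
pose g (a : add_vertex T) : N := oapp (fun u => val (f u)) x a.
have g_inj : injective g.
  have neq u : val (f u) <> x by apply/eqP/(valP (f u)).
  by move=> [u|] [v|] //= => [/val_inj/(bij_inj f_bij) -> | /neq | /esym/neq].
(* The copy of [u] has degree k+1 in [M] but at least k+2 in [N], so it must have lost the neighbour
   [x]. *)
have x_adj u : u \in T -> adj (val (f u)) x.
  rewrite inE -(iso_deg u f_bij f_adj) => /eqP du; have := N_degM (f u).
  by rewrite du; case: adj; rewrite // ltnn.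
have G'N : has_model (add_vertex T) N.
  apply: (embedding_model g_inj) => -[u|] [v|] //= => [|/x_adj|/x_adj] //.
  - by rewrite -f_adj.
  - by rewrite adj_sym.
(* G' would be no larger than [N], hence no larger than its proper minor [H]. *)
have := leq_trans (model_size G'N) (model_size (minor_model NH)).
by rewrite leqNgt proper_minor_size.
Qed.
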